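(* $M^5$ is homeomorphic to $\mathbb{R}P^2\times\mathbb{R}P^3$.
   Context: Real $3\times3$ matrices are identified with points of Euclidean space $\mathbb{R}^9$, and $S^8(\sqrt3)$ is the round sphere of matrices $A$ with $\sum_{i,j}a_{ij}^2=3$. A ''best'' $3\times3$ matrix of rank $2$ is one which is orthogonal (i.e. restricts to a linear isometry onto its image) on a $2$-plane through the origin in $\mathbb{R}^3$ and zero on the orthogonal complement of that plane. $M^5$ is the set of best $3\times3$ matrices of rank $2$, scaled up to lie on $S^8(\sqrt3)$ (i.e. multiplied by $\sqrt{3/2}$), with the subspace topology. *)

(* Defs.v *)
From HB Require Import structures.
From mathcomp Require Import all_boot all_order all_algebra.
From mathcomp Require Import all_classical all_reals all_analysis.

Set Implicit Arguments.
Unset Strict Implicit.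
Unset Printing Implicit Defensive.

Import Order.TTheory GRing.Theory Num.Theory.
Import numFieldNormedType.Exports.

Local Open Scope classical_set_scope.
Local Open Scope ring_scope.
Local Open Scope quotient_scope.

Definition homeomorphic (X Y : topologicalType) : Prop :=
  exists (f : X -> Y) (g : Y -> X),
    [/\ cancel f g, cancel g f, continuous f & continuous g].

Definition dotv (R : realType) (n : nat) (x y : 'cV[R]_n) : R :=
  \sum_(i < n) x i 0 * y i 0.

(* The library norm `|x| on matrices is the sup norm; it induces the same
   topology as the Euclidean norm, but not the same unit sphere or isometries. *)
Definition enorm (R : realType) (n : nat) (x : 'cV[R]_n) : R :=
  Num.sqrt (dotv x x).

Definition sphere (R : realType) (n : nat) : set 'cV[R]_n.+1 :=
  [set x | enorm x = 1].

Definition antipodal (R : realType) (n : nat) : rel (set_type (@sphere R n)) :=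
  fun x y => (val x == val y) || (val x == - val y).

Lemma antipodal_equiv (R : realType) (n : nat) :
  equiv_class_of (@antipodal R n).
Proof.
split=> [x | x y | y x z].
- by rewrite /antipodal eqxx.
- by rewrite /antipodal [val x == val y]eq_sym -[val x == _]eqr_oppLR
    [- val x == _]eq_sym.
- rewrite /antipodal => /orP[] /eqP-> // /orP[] /eqP->;
  by rewrite ?opprK eqxx ?orbT.
Qed.

Canonical antipodal_equiv_rel (R : realType) (n : nat) :=
  EquivRelPack (@antipodal_equiv R n).

Definition RP (R : realType) (n : nat) : topologicalType :=
  quotient_topology {eq_quot (@antipodal_equiv_rel R n)}.

(* A matrix acts on column vectors by x |-> A *m x. *)
Definition best_rank2 (R : realType) (A : 'M[R]_3) : Prop :=
  exists P : {vspace 'cV[R]_3},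
    [/\ \dim P = 2%N,
        {in P &, forall x y, enorm (A *m x - A *m y) = enorm (x - y)} &
        forall x, {in P, forall y, dotv x y = 0} -> A *m x = 0].

(* The factor sqrt (3 / 2) puts these matrices on the sphere of radius sqrt 3,
   since a best matrix of rank 2 has squared entries summing to 2. *)
Definition M5 (R : realType) : set 'M[R]_3 :=
  [set Num.sqrt (3 / 2) *: A | A in @best_rank2 R].

(* Main.v *)
Require Import Defs.
From mathcomp Require Import all_boot all_order all_algebra.
From mathcomp Require Import all_classical all_reals all_analysis.
From mathcomp Require Import ring lra.

Import numFieldNormedType.Exports.
Set Implicit Arguments.
Unset Strict Implicit.
Unset Printing Implicit Defensive.
Import Order.TTheory GRing.Theory Num.Theory.
Local Open Scope classical_set_scope.
Local Open Scope ring_scope.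

(** A best matrix [A] of rank 2 loses its kernel line and nothing else: if [n]
    is a unit normal of the plane on which [A] is isometric, then [A] kills [n]
    and [A] extends in exactly one way to a rotation [Q], by sending [n] to the
    unit normal of the image plane which is compatible with orientation.  So
    [A = Q (1 - n n^T)], and the pair (line of [n], rotation [Q]) is a complete
    invariant: [A^T A = 1 - n n^T] recovers the line, and [A + (\adj A)^T = Q]
    recovers the rotation, because the cofactor matrix of [1 - n n^T] is [n n^T]
    (lemmas [best_rank2P], [gram_proj_SO3], [SO3_proj_gram] and
    [SO3_proj_recover]).

    Rotations are parametrised by unit quaternions up to sign through the
    polynomial map [rot] (lemmas [rot_SO3], [rot_inj], [rot_surj]), so a pair
    (line, rotation) is a point of [RP R 2 * RP R 3].  The map [rot_proj] sending
    such a point to [rot q *m (1 - n n^T)] is thus a bijection onto the best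
    matrices of rank 2.  It is continuous, since its two factors are polynomial
    and even, its source is compact and its target is Hausdorff; its inverse is
    therefore continuous as well, and rescaling by a nonzero constant changes
    nothing. *)

(** * Adjugate matrices *)

Lemma ord3_ind (P : 'I_3 -> Prop) : P 0 -> P 1 -> P 2 -> forall i, P i.
Proof.
by move=> P0 P1 P2 [[|[|[|//]]] i]; [move: P0|move: P1|move: P2];
  congr P; apply: val_inj.
Qed.

Lemma ord4_ind (P : 'I_4 -> Prop) : P 0 -> P 1 -> P 2 -> P 3 -> forall i, P i.
Proof.
by move=> P0 P1 P2 P3 [[|[|[|[|//]]]] i];
  [move: P0|move: P1|move: P2|move: P3]; congr P; apply: val_inj.
Qed.

Lemma sum_ord3 (V : nmodType) (F : 'I_3 -> V) : \sum_i F i = F 0 + F 1 + F 2.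
Proof.
by rewrite !big_ord_recl big_ord0 addr0 addrA; congr (F _ + F _ + F _);
  apply: val_inj.
Qed.

Lemma sum_ord4 (V : nmodType) (F : 'I_4 -> V) :
  \sum_i F i = F 0 + F 1 + F 2 + F 3.
Proof.
by rewrite !big_ord_recl big_ord0 addr0 !addrA; congr (F _ + F _ + F _ + F _);
  apply: val_inj.
Qed.

(** Reading indices modulo 3 absorbs the signs of the cofactors. *)
Lemma adj_mx3E (R : comNzRingType) (A : 'M[R]_3) i j : \adj A i j =
   A (j + 1) (i + 1) * A (j + 2) (i + 2) - A (j + 1) (i + 2) * A (j + 2) (i + 1).
Proof.
(* As a function of natural numbers, [a] lets the indices produced by the two
   cofactor expansions be evaluated. *)
pose a m n : R := A (inord m) (inord n).
have aE k l : A k l = a k l by rewrite /a !inord_val.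
rewrite mxE /cofactor.
rewrite (expand_det_row _ 0) !big_ord_recl big_ord0 /cofactor !det_mx11 !mxE !aE.
by move: i j; elim/ord3_ind; elim/ord3_ind; rewrite /= /bump /=; ring.
Qed.

Lemma ord3_addE : (0 + 1 = 1 :> 'I_3) * (1 + 1 = 2 :> 'I_3) *
  (2 + 1 = 0 :> 'I_3) * (0 + 2 = 2 :> 'I_3) * (1 + 2 = 0 :> 'I_3) *
  (2 + 2 = 1 :> 'I_3).
Proof. by do !split; apply: val_inj. Qed.

(** The identity is clear when both determinants are regular.  Replacing [A] and
    [B] by ['X + A] and ['X + B] makes the determinants monic, hence regular;
    evaluation at 0 then gives the general case. *)
Lemma adjM (R : comNzRingType) n (A B : 'M[R]_n) :
  \adj (A *m B) = \adj B *m \adj A.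
Proof.
pose X (C : 'M[R]_n) := char_poly_mx (- C).
have X0 C : map_mx (horner_eval 0) (X C) = C.
  apply/matrixP => i j.
  by rewrite !mxE /horner_eval !hornerE hornerMn hornerX mul0rn sub0r opprK.
have regX (C : 'M[R]_n) (D : 'M[{poly R}]_n) : \det (X C) *: D = 0 -> D = 0.
  move=> D0; apply/matrixP => i j; rewrite mxE.
  apply: (monic_lreg (char_poly_monic (- C))).
  by move/matrixP: D0 => /(_ i j); rewrite !mxE => ->; rewrite mulr0.
rewrite -[in LHS](X0 A) -[in LHS](X0 B) -[in RHS](X0 A) -[in RHS](X0 B).
rewrite -map_mxM -!map_mx_adj -map_mxM; congr map_mx.
move: (X A) (X B) (regX A) (regX B) => A' B' regA regB.
apply/subr0_eq/regA/regB.
have AB_adj : A' *m B' *m (\adj B' *m \adj A') = (\det (A' *m B'))%:M.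
  rewrite -mulmxA (mulmxA B') mul_mx_adj mul_scalar_mx -scalemxAr mul_mx_adj.
  by rewrite scale_scalar_mx mulrC -det_mulmx.
rewrite scalerA mulrC -det_mulmx -mul_scalar_mx -mul_adj_mx -mulmxA mulmxBr.
by rewrite AB_adj mul_mx_adj subrr mulmx0.
Qed.

Lemma det_mx3E (R : comNzRingType) (A : 'M[R]_3) : \det A =
  A 0 0 * (A 1 1 * A 2 2 - A 1 2 * A 2 1)
  - A 0 1 * (A 1 0 * A 2 2 - A 1 2 * A 2 0)
  + A 0 2 * (A 1 0 * A 2 1 - A 1 1 * A 2 0).
Proof.
have /matrixP/(_ 0 0) := mul_mx_adj A.
rewrite !mxE sum_ord3 !adj_mx3E !ord3_addE /= mulr1n => <-; ring.
Qed.

Section Rank2.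
Variable R : realType.

(** * Unit vectors and projections *)

Definition unitv n (x : 'cV[R]_n) := x^T *m x = 1%:M.

Lemma dotvE n (x y : 'cV[R]_n) : dotv x y = (x^T *m y) 0 0.
Proof. by rewrite mxE; apply: eq_bigr => i _; rewrite mxE. Qed.

Lemma unitvE n (x : 'cV[R]_n) : unitv x <-> dotv x x = 1.
Proof.
rewrite dotvE; split=> [->|x1]; first by rewrite mxE.
by apply/matrixP => i j; rewrite !ord1 x1 mxE.
Qed.

Lemma dotv_ge0 n (x : 'cV[R]_n) : 0 <= dotv x x.
Proof. by apply: sumr_ge0 => i _; rewrite -expr2 sqr_ge0. Qed.

Lemma dotv_eq0 n (x : 'cV[R]_n) : dotv x x = 0 -> x = 0.
Proof.
rewrite /dotv => /eqP; rewrite psumr_eq0 => [/allP Z|i _]; last first.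
  by rewrite -expr2 sqr_ge0.
apply/matrixP => i j; rewrite !ord1 [RHS]mxE.
by have := Z i (mem_index_enum i); rewrite /= mulf_eq0 orbb => /eqP.
Qed.

Lemma unitv_neq0 n (x : 'cV[R]_n) : unitv x -> x != 0.
Proof.
move=> x1; apply/eqP => x0; move/matrixP: x1 => /(_ 0 0).
by rewrite x0 mulmx0 !mxE => /esym/eqP; rewrite oner_eq0.
Qed.

Lemma unitv_sphere n (x : 'cV[R]_n.+1) : @sphere R n x <-> unitv x.
Proof.
rewrite unitvE /sphere /= /enorm; split=> [x1|->]; last exact: sqrtr1.
by rewrite -(sqr_sqrtr (dotv_ge0 x)) x1 expr1n.
Qed.

(** Applying [x x^T = y y^T] to [x] shows that [x] is a multiple of [y]. *)
Lemma outer_inj n (x y : 'cV[R]_n) : unitv x -> unitv y ->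
  x *m x^T = y *m y^T -> x = y \/ x = - y.
Proof.
move=> x1 y1 xy; pose c := (y^T *m x) 0 0.
have xE : x = c *: y.
  by rewrite -mul_mx_scalar -mx11_scalar mulmxA -xy -mulmxA x1 mulmx1.
have /matrixP/(_ 0 0) : (c ^+ 2)%:M = 1%:M :> 'M[R]_1.
  rewrite -x1 xE [(_ *: _)^T]linearZ /= -scalemxAl -scalemxAr scalerA -expr2 y1.
  by rewrite scale_scalar_mx mulr1.
rewrite !mxE => /eqP; rewrite sqrf_eq1 xE => /orP[] /eqP->.
  by left; rewrite scale1r.
by right; rewrite scaleN1r.
Qed.

(** For a unit vector [x], the orthogonal projection onto the hyperplane normal
    to [x]. *)
Definition proj n (x : 'cV[R]_n) : 'M[R]_n := 1%:M - x *m x^T.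

Lemma projN n (x : 'cV[R]_n) : proj (- x) = proj x.
Proof. by rewrite /proj linearN /= mulNmx mulmxN opprK. Qed.

Lemma tr_proj n (x : 'cV[R]_n) : (proj x)^T = proj x.
Proof. by rewrite /proj linearB /= trmx1 trmx_mul trmxK. Qed.

Lemma proj_ker n (x : 'cV[R]_n) : unitv x -> proj x *m x = 0.
Proof. by move=> x1; rewrite mulmxBl mul1mx -mulmxA x1 mulmx1 subrr. Qed.

Lemma proj_idem n (x : 'cV[R]_n) : unitv x -> proj x *m proj x = proj x.
Proof.
by move=> x1; rewrite {2}/proj mulmxBr mulmx1 mulmxA proj_ker // mul0mx subr0.
Qed.

Lemma adj_proj (x : 'cV[R]_3) : unitv x -> \adj (proj x) = x *m x^T.
Proof.
rewrite unitvE /dotv sum_ord3 => x1; apply/matrixP.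
elim/ord3_ind; elim/ord3_ind; rewrite adj_mx3E !ord3_addE !mxE !big_ord1 !mxE;
  rewrite -!val_eqE /=; lra.
Qed.

(** * Rotations and the factorisation of rank 2 matrices *)

Definition SO3 (Q : 'M[R]_3) := Q^T *m Q = 1%:M /\ \det Q = 1.

Lemma SO3_adj Q : SO3 Q -> \adj Q = Q^T.
Proof.
case=> QQ detQ; rewrite -[LHS]mulmx1 -(mulmx1C QQ) mulmxA mul_adj_mx detQ.
by rewrite mul1mx.
Qed.

(** The cofactor matrix [C] of [A] satisfies [C^T C = n n^T] and [A^T C = 0]: it
    is the rank 1 piece which is missing for [A] to be orthogonal.  The sign of
    [\det (A + C)] is right because the cofactor matrix of [(A + C) (proj n)] is
    both [C] and [\det (A + C) *: C]. *)
Lemma gram_proj_SO3 (A : 'M[R]_3) n : unitv n -> A^T *m A = proj n ->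
  SO3 (A + (\adj A)^T) /\ A = (A + (\adj A)^T) *m proj n.
Proof.
move=> n1 AA; set C := (\adj A)^T.
have An0 : A *m n = 0.
  apply: dotv_eq0.
  rewrite dotvE trmx_mul mulmxA -(mulmxA _ A^T) AA -mulmxA proj_ker //.
  by rewrite mulmx0 mxE.
have detA0 : \det A = 0.
  have : \adj A *m A *m n = 0 by rewrite -mulmxA An0 mulmx0.
  rewrite mul_adj_mx mul_scalar_mx => /eqP; rewrite scaler_eq0.
  by rewrite (negPf (unitv_neq0 n1)) orbF => /eqP.
have AG : A *m proj n = A by rewrite mulmxBr mulmx1 mulmxA An0 mul0mx subr0.
have CN : C *m (n *m n^T) = C.
  by rewrite /C -[in RHS]AG adjM adj_proj // [RHS]trmx_mul trmx_mul trmxK.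
have CC : C^T *m C = n *m n^T.
  by rewrite /C trmxK trmx_adj -adjM AA adj_proj.
have AC : A^T *m C = 0.
  by rewrite /C -trmx_mul mul_adj_mx detA0 -scalemx1 scale0r trmx0.
have CA : C^T *m A = 0.
  by rewrite -[LHS]trmxK trmx_mul trmxK AC trmx0.
set Q := A + C.
have QG : Q *m proj n = A.
  by rewrite mulmxDl AG mulmxBr mulmx1 CN subrr addr0.
have QQ : Q^T *m Q = 1%:M.
  rewrite /Q [(A + C)^T]linearD /= mulmxDl !mulmxDr AC CA AA CC addr0 add0r.
  by rewrite /proj subrK.
split; last by rewrite QG.
split=> //.
have adjQ : \adj Q = \det Q *: Q^T.
  by rewrite -[LHS]mulmx1 -(mulmx1C QQ) mulmxA mul_adj_mx mul_scalar_mx.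
have QN : Q *m (n *m n^T) = C.
  by rewrite mulmxDl mulmxA An0 mul0mx add0r CN.
have : C = \det Q *: C.
  rewrite -[in RHS]QN {1}/C -[in LHS]QG adjM adjQ adj_proj //.
  by rewrite -scalemxAr [LHS]linearZ /= !trmx_mul !trmxK.
move/eqP; rewrite -subr_eq0 -{1}[C]scale1r -scalerBl scaler_eq0 subr_eq0.
case/orP => [/eqP<-//|/eqP C0]; have := unitv_neq0 n1.
by rewrite -[n]mulmx1 -n1 mulmxA -CC C0 mulmx0 mul0mx eqxx.
Qed.

Lemma SO3_proj_gram Q (n : 'cV[R]_3) : SO3 Q -> unitv n ->
  (Q *m proj n)^T *m (Q *m proj n) = proj n.
Proof.
case=> QQ _ n1; rewrite trmx_mul mulmxA -(mulmxA _ Q^T) QQ mulmx1 tr_proj.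
exact: proj_idem.
Qed.

(** Cofactor matrices are multiplicative, that of a rotation is the rotation
    itself, and that of [proj n] is [n n^T]. *)
Lemma SO3_proj_recover Q (n : 'cV[R]_3) : SO3 Q -> unitv n ->
  Q *m proj n + (\adj (Q *m proj n))^T = Q.
Proof.
move=> SQ n1; rewrite adjM adj_proj // SO3_adj // !trmx_mul !trmxK -mulmxDr.
by rewrite /proj subrK mulmx1.
Qed.

(** * Rotations as unit quaternions *)

(** The matrix of the rotation [v |-> q v q^-1] of the imaginary quaternions, for
    a unit quaternion [q = a + b i + c j + d k]. *)
Definition rot (q : 'cV[R]_4) : 'M[R]_3 :=
  let: (a, b, c, d) := (q 0 0, q 1 0, q 2 0, q 3 0) in
  \matrix_(i, j) nth 0 (nth [::]
   [:: [:: a^+2 + b^+2 - c^+2 - d^+2; 2 * (b*c - a*d); 2 * (b*d + a*c)];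
       [:: 2 * (b*c + a*d); a^+2 - b^+2 + c^+2 - d^+2; 2 * (c*d - a*b)];
       [:: 2 * (b*d - a*c); 2 * (c*d + a*b); a^+2 - b^+2 - c^+2 + d^+2]] i) j.

Lemma rotN q : rot (- q) = rot q.
Proof. by rewrite /rot !mxE !sqrrN !mulrNN. Qed.

Lemma rot_SO3 q : unitv q -> SO3 (rot q).
Proof.
rewrite unitvE /dotv sum_ord4.
set a := q 0 0; set b := q 1 0; set c := q 2 0; set d := q 3 0 => q1.
(* The entries of [rot q] are quadratic forms, so orthogonality is an identity
   of degree 4 and the determinant one of degree 6: the equation of the sphere
   is needed to the powers 2 and 3. *)
have q2 : (a * a + b * b + c * c + d * d) ^+ 2 = 1 by rewrite q1 expr1n.
have q3 : (a * a + b * b + c * c + d * d) ^+ 3 = 1 by rewrite q1 expr1n.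
split; last by rewrite det_mx3E !mxE /= -/a -/b -/c -/d; lra.
apply/matrixP; elim/ord3_ind; elim/ord3_ind;
  rewrite !mxE sum_ord3 !mxE -!val_eqE /= -/a -/b -/c -/d; lra.
Qed.

(** The entries of [rot q] and the equation of the sphere determine the products
    [q_i q_j] linearly. *)
Lemma rot_inj p q : unitv p -> unitv q -> rot p = rot q -> p = q \/ p = - q.
Proof.
move=> p1 q1 /matrixP pq; apply: outer_inj => //.
move: p1 q1; rewrite !unitvE /dotv !sum_ord4 => p1 q1.
have {pq} E i j := pq i j.
move: (E 0 0) (E 0 1) (E 0 2) (E 1 0) (E 1 1) (E 1 2) (E 2 0) (E 2 1) (E 2 2).
rewrite !mxE /= => {E} e00 e01 e02 e10 e11 e12 e20 e21 e22.
apply/matrixP; elim/ord4_ind; elim/ord4_ind; rewrite !mxE !big_ord1 !mxE; lra.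
Qed.

(** The matrix [4 q q^T], written in terms of the entries of [Q = rot q] for a
    unit quaternion [q]. *)
Definition qouter (Q : 'M[R]_3) : 'M[R]_4 :=
  \matrix_(i, j) nth 0 (nth [::]
   [:: [:: 1 + Q 0 0 + Q 1 1 + Q 2 2; Q 2 1 - Q 1 2;
           Q 0 2 - Q 2 0; Q 1 0 - Q 0 1];
       [:: Q 2 1 - Q 1 2; 1 + Q 0 0 - Q 1 1 - Q 2 2;
           Q 1 0 + Q 0 1; Q 2 0 + Q 0 2];
       [:: Q 0 2 - Q 2 0; Q 1 0 + Q 0 1;
           1 - Q 0 0 + Q 1 1 - Q 2 2; Q 2 1 + Q 1 2];
       [:: Q 1 0 - Q 0 1; Q 2 0 + Q 0 2;
           Q 2 1 + Q 1 2; 1 - Q 0 0 - Q 1 1 + Q 2 2]] i) j.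

(** The relations between the entries of a rotation that matter are quadratic:
    [Q^T Q = 1], [Q Q^T = 1], and that [Q] is its own cofactor matrix.  The 2 x 2
    minors below are linear combinations of them. *)
Lemma qouter_rank1 Q : SO3 Q ->
  forall i j k, qouter Q i j * qouter Q i k = qouter Q i i * qouter Q j k.
Proof.
move=> SQ; have /matrixP adjQ := SO3_adj SQ; case: SQ => QQ _.
have /matrixP QQ' := mulmx1C QQ; move/matrixP: QQ => QQ.
move: (adjQ 0 0) (adjQ 0 1) (adjQ 0 2) (adjQ 1 0) (adjQ 1 1) (adjQ 1 2)
  (adjQ 2 0) (adjQ 2 1) (adjQ 2 2).
rewrite !adj_mx3E !ord3_addE !mxE => a00 a01 a02 a10 a11 a12 a20 a21 a22.
move: (QQ 0 0) (QQ 0 1) (QQ 0 2) (QQ 1 1) (QQ 1 2) (QQ 2 2).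
rewrite !mxE !sum_ord3 !mxE /= => q00 q01 q02 q11 q12 q22.
move: (QQ' 0 0) (QQ' 0 1) (QQ' 0 2) (QQ' 1 1) (QQ' 1 2) (QQ' 2 2).
rewrite !mxE !sum_ord3 !mxE /= => r00 r01 r02 r11 r12 r22.
elim/ord4_ind; elim/ord4_ind; elim/ord4_ind; rewrite !mxE /=;
  first [ring | lra].
Qed.

(** A column of the rank 1 symmetric matrix [qouter Q], suitably scaled, is a
    vector [q].  The trace of [qouter Q] is 4, so some diagonal entry is positive
    and can serve as the scale. *)
Lemma qouter_decomp Q : SO3 Q ->
  exists q : 'cV[R]_4, forall j k, q j 0 * q k 0 = qouter Q j k / 4.
Proof.
move=> /qouter_rank1 K1; set K := qouter Q in K1 *.
have [i Ki0] : exists i, 0 < K i i.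
  apply/not_existsP => K0.
  have {}K0 i : K i i <= 0 by rewrite leNgt; apply/negP/K0.
  by move: (K0 0) (K0 1) (K0 2) (K0 3); rewrite !mxE /=; lra.
clearbody K; exists (\col_j (K i j / (2 * Num.sqrt (K i i)))) => j k.
have s2 := sqr_sqrtr (ltW Ki0).
have s0 : Num.sqrt (K i i) != 0 by rewrite gt_eqF // sqrtr_gt0.
by rewrite !mxE; set s := Num.sqrt _ in s2 s0 *; rewrite mulrACA K1 -s2; field.
Qed.

Lemma rot_surj Q : SO3 Q -> exists2 q, unitv q & rot q = Q.
Proof.
move=> /qouter_decomp[q qq]; exists q.
  rewrite unitvE /dotv sum_ord4 !qq !mxE /=; lra.
move: (qq 0 0) (qq 1 1) (qq 2 2) (qq 3 3) (qq 0 1) (qq 0 2) (qq 0 3)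
  (qq 1 2) (qq 1 3) (qq 2 3).
rewrite !mxE /= => q00 q11 q22 q33 q01 q02 q03 q12 q13 q23.
apply/matrixP; elim/ord3_ind; elim/ord3_ind; rewrite !mxE /=; lra.
Qed.

(** * Gram matrices of best matrices of rank 2 *)

(** A nonzero vector orthogonal to the two vectors of a basis of [P] exists
    because a 3 x 2 matrix has a left kernel.  It spans a complement of [P], so
    vanishing of the product with it characterises [P]. *)
Lemma exists_normal (P : {vspace 'cV[R]_3}) : \dim P = 2%N ->
  exists2 n, unitv n & forall x, (x \in P) = (dotv n x == 0).
Proof.
move=> dimP; pose B := \matrix_(i < 3, j < \dim P) (vbasis P)`_j i 0.
have rkB : (\rank B < 3)%N by rewrite (leq_ltn_trans (rank_leq_col B)) ?dimP.
have : kermx B != 0 by rewrite -mxrank_eq0 mxrank_ker subn_eq0 -ltnNge.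
case/rowV0Pn => u /sub_kermxP uB u0; pose m := u^T.
have m0 : m != 0 by rewrite trmx_eq0.
have mm : 0 < dotv m m.
  by rewrite lt_def dotv_ge0 andbT; apply: contraNneq m0 => /dotv_eq0 ->.
pose n := (enorm m)^-1 *: m.
have en0 : enorm m != 0 by rewrite gt_eqF // sqrtr_gt0.
have n1 : unitv n.
  apply/unitvE; rewrite dotvE [n^T]linearZ /= -scalemxAl -scalemxAr scalerA mxE.
  rewrite -dotvE -[dotv m m]sqr_sqrtr ?dotv_ge0 // -/(enorm m).
  by rewrite expr2 mulrACA mulVf // mulr1.
have nP x : x \in P -> dotv n x = 0.
  move=> /coord_vbasis ->; rewrite dotvE mulmx_sumr summxE big1 // => i _.
  rewrite -scalemxAr [n^T]linearZ /= trmxK -scalemxAl !mxE.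
  move/matrixP: uB => /(_ 0 i); rewrite !mxE => uBi.
  rewrite (eq_bigr (fun j => u 0 j * B j i)) ?uBi ?mulr0 // => j _.
  by rewrite mxE.
exists n => // x; apply/idP/eqP => [/nP //|nx0].
have nnP : n \notin P.
  by apply/negP => /nP nn; move/unitvE: n1 => /eqP; rewrite nn eq_sym oner_eq0.
have : x \in (P + <[n]>)%VS.
  suff -> : (P + <[n]>)%VS = fullv by rewrite memvf.
  apply/eqP; rewrite -(dimv_leqif_eq (subvf _)) dimvf /dim /= muln1.
  rewrite dimv_disjoint_sum ?dimP ?dim_vline ?unitv_neq0 //.
  apply/eqP; rewrite -subv0; apply/subvP => y; rewrite memv_cap memv0.
  case/andP => yP /vlineP[k yk]; move: yP; rewrite yk.
  have [->|k0] := eqVneq k 0; first by rewrite scale0r eqxx.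
  by move=> /(memvZ k^-1); rewrite scalerA mulVf // scale1r (negPf nnP).
case/memv_addP => p pP [_ /vlineP[k ->] xE].
have : dotv n x = k.
  rewrite xE dotvE mulmxDr mxE -dotvE nP // add0r -scalemxAr n1 !mxE /=.
  by rewrite mulr1.
by rewrite nx0 xE => <-; rewrite scale0r addr0.
Qed.

Lemma normal_plane (n : 'cV[R]_3) : unitv n ->
  exists2 P : {vspace 'cV[R]_3}, \dim P = 2%N &
    forall x, (x \in P) = (dotv n x == 0).
Proof.
move=> n1.
pose f : 'Hom('cV[R]_3, 'cV[R]_1) := linfun (mulmx n^T).
have fE x : f x = n^T *m x by rewrite lfunE.
exists (lker f).
  have := limg_ker_dim f fullv; rewrite capfv dimvf.
  have -> : limg f = fullv.
    apply/vspaceP => y; rewrite memvf; apply/memv_imgP; exists (y 0 0 *: n).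
      by rewrite memvf.
    by rewrite fE -scalemxAr n1 scalemx1 -mx11_scalar.
  rewrite dimvf /dim /= ?muln1 => /eqP.
  by rewrite (eqn_add2r 1 _ 2) => /eqP.
move=> x; rewrite memv_ker fE dotvE; apply/eqP/eqP => [->|nx]; first by rewrite mxE.
by apply/matrixP => i j; rewrite !ord1 nx mxE.
Qed.

(** Polarisation, by which a linear isometry preserves dot products. *)
Lemma dotv_polar n (x y : 'cV[R]_n) :
  dotv x y = (dotv x x + dotv y y - enorm (x - y) ^+ 2) / 2.
Proof.
rewrite sqr_sqrtr ?dotv_ge0 // /dotv -!big_split -sumrB mulr_suml.
by apply: eq_bigr => i _; rewrite !mxE /=; field.
Qed.

(** In terms of the Gram matrix: [A^T A] is the orthogonal projection onto the
    plane on which [A] is isometric. *)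
Lemma best_rank2P (A : 'M[R]_3) :
  best_rank2 A <-> exists2 n, unitv n & A^T *m A = proj n.
Proof.
split.
  case=> P [dimP isoP kerP]; have [n n1 nP] := exists_normal dimP; exists n => //.
  have dotA x y : x \in P -> y \in P -> dotv (A *m x) (A *m y) = dotv x y.
    move=> xP yP; rewrite (dotv_polar x) (dotv_polar (A *m x)) isoP //.
    have sq z : z \in P -> dotv (A *m z) (A *m z) = dotv z z.
      move=> zP; have := isoP z 0 zP (mem0v P); rewrite mulmx0 !subr0.
      rewrite -(sqr_sqrtr (dotv_ge0 z)) -(sqr_sqrtr (dotv_ge0 (A *m z))).
      by rewrite /enorm => ->.
    by rewrite !sq.
  have projP x : proj n *m x \in P.
    by rewrite nP dotvE mulmxA -tr_proj -trmx_mul proj_ker // trmx0 mul0mx mxE.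
  have An0 : A *m n = 0.
    by apply: kerP => y; rewrite nP => /eqP.
  have AG : A *m proj n = A by rewrite mulmxBr mulmx1 mulmxA An0 mul0mx subr0.
  have E (M : 'M[R]_3) i j :
      M i j = ((delta_mx 0 i : 'rV_3) *m M *m (delta_mx 0 j : 'rV_3)^T) 0 0.
    by rewrite -rowE trmx_delta -colE !mxE.
  apply/matrixP => i j; rewrite [LHS]E [RHS]E.
  set x := delta_mx 0 i; set y := delta_mx 0 j.
  (* Any vectors can be fed to [dotA] after projection to [P], and the projection
     is absorbed by [A] on the left and is idempotent on the right. *)
  have := dotA _ _ (projP x^T) (projP y^T).
  rewrite !mulmxA AG !dotvE !trmx_mul !trmxK tr_proj !mulmxA => ->.
  by rewrite -(mulmxA x (proj n) (proj n)) proj_idem.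
case=> n n1 AA; have [P dimP nP] := normal_plane n1; exists P; split=> //.
  move=> x y xP yP; rewrite -mulmxBr; move: (memvB xP yP) => {xP yP}.
  move: (x - y) => {x y} x; rewrite nP => /eqP nx.
  rewrite /enorm !dotvE trmx_mul mulmxA -(mulmxA _ A^T) AA mulmxBr mulmxBl.
  rewrite mulmx1 mulmxA -[_ *m _ *m x]mulmxA (_ : n^T *m x = 0).
    by rewrite mulmx0 subr0.
  by apply/matrixP => i j; rewrite !ord1 -dotvE nx mxE.
move=> x xP; apply: dotv_eq0.
have px : proj n *m x = 0.
  apply: dotv_eq0; have pP : proj n *m x \in P.
    by rewrite nP dotvE mulmxA -tr_proj -trmx_mul proj_ker // trmx0 mul0mx mxE.
  have := xP _ pP; rewrite !dotvE trmx_mul tr_proj !mulmxA.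
  by rewrite -(mulmxA _ (proj n) (proj n)) proj_idem.
by rewrite dotvE trmx_mul mulmxA -(mulmxA _ A^T) AA -mulmxA px mulmx0 mxE.
Qed.

End Rank2.

(** * Compactness and continuity *)

Lemma hausdorff_set_type (T : topologicalType) (A : set T) :
  hausdorff_space T -> hausdorff_space (set_type A).
Proof.
move=> hT x y xy; apply: val_inj; apply: hT => U V xU yV.
have cval : continuous (set_val : set_type A -> T) by exact: initial_continuous.
have [z [Uz Vz]] := xy _ _ (cval x _ xU) (cval y _ yV).
by exists (set_val z).
Qed.

(** A cluster point in [A] of the image filter is a cluster point of the filter
    on the subtype, since the open sets of the subtype are traces. *)
Lemma compact_set_type (T : topologicalType) (A : set T) :
  compact A -> compact [set: set_type A].
Proof.
move=> cA F PF _.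
have FA : F ((set_val : set_type A -> T) @^-1` A).
  by apply: filterE => -[x xA]; exact: set_mem.
have [p [Ap clp]] := cA ((set_val : set_type A -> T) @ F) _ FA.
exists (exist _ p (mem_set Ap) : set_type A); split=> // B U FB.
move=> [V [oV Vp sVU]].
case: oV Vp sVU => W oW <- Wp sWU.
have FB' : F ((set_val : set_type A -> T) @^-1` (set_val @` B)).
  by apply: filterS FB => b Bb; exists b.
have [//|_ [[b Bb <-] Wb]] := clp (set_val @` B) W FB'.
  exact: open_nbhs_nbhs.
by exists b; split=> //; apply: sWU.
Qed.

(** A closed set of [Y] is compact, so its image under [g] is compact, hence
    closed: the inverse of [g] is continuous. *)
Lemma homeomorphic_compact_hausdorff (X Y : topologicalType) (g : Y -> X) :
  compact [set: Y] -> hausdorff_space X -> continuous g ->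
  injective g -> (forall x, exists y, g y = x) -> homeomorphic X Y.
Proof.
move=> cY hX cg ig sg; have /choice[f fK] := sg.
exists f, g; split=> //; first by move=> y; apply: ig.
apply/continuous_closedP => C cC.
have -> : f @^-1` C = g @` C.
  rewrite eqEsubset; split=> x /=; first by exists (f x).
  by case=> y Cy <-; rewrite (_ : f (g y) = y) //; apply: ig.
apply: compact_closed => //; apply: continuous_compact.
  exact: continuous_subspaceT.
exact: subclosed_compact cC cY _.
Qed.

Lemma continuous_mx (T : topologicalType) (R : topologicalType) m n
    (f : T -> 'M[R]_(m, n)) :
  (forall i j, continuous (fun t => f t i j)) -> continuous f.
Proof.
move=> cf t U [P tP sPU].
have : \forall s \near t, forall i j, P i j (f s i j).
  apply: filter_forall => i; apply: filter_forall => j.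
  exact: (cf i j t _ (tP i j)).
by apply: filterS => s Ps; apply: sPU.
Qed.

Lemma continuous_sum (R : realType) (T : topologicalType) (I : finType)
    (F : I -> T -> R) :
  (forall i, continuous (F i)) -> continuous (fun t => \sum_i F i t).
Proof.
move=> cF; rewrite -fct_sumE; elim/big_ind: _ => [|f g cf cg|i _] //.
  exact: cst_continuous.
by move=> t; apply: (continuousD (cf t) (cg t)).
Qed.

Lemma continuous_mulmx (R : realType) (T : topologicalType) m n p
    (f : T -> 'M[R]_(m, n)) (g : T -> 'M[R]_(n, p)) :
  continuous f -> continuous g -> continuous (fun t => f t *m g t).
Proof.
move=> cf cg; apply: continuous_mx => i j.
under eq_fun do rewrite mxE.
apply: continuous_sum => k t; apply: continuousM.
  exact: (continuous_comp (cf t) (@coord_continuous _ _ _ i k _)).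
exact: (continuous_comp (cg t) (@coord_continuous _ _ _ k j _)).
Qed.

Lemma continuous_trmx (R : realType) m n :
  continuous (trmx : 'M[R]_(m, n) -> 'M[R]_(n, m)).
Proof.
apply: continuous_mx => i j; under eq_fun do rewrite mxE.
exact: coord_continuous.
Qed.

(** * Real projective spaces *)

(** The sphere is a closed subset of the cube with coordinates in [-1, 1], which
    is compact by Tychonoff's theorem; that theorem is about row vectors, whence
    the transposition. *)
Lemma sphere_compact (R : realType) n : compact (@sphere R n).
Proof.
have -> : @sphere R n = trmx @` [set u : 'rV[R]_n.+1 | dotv u^T u^T = 1].
  rewrite eqEsubset; split=> x /=.
    by move=> x1; exists x^T; rewrite trmxK //; apply/unitvE/unitv_sphere.
  by case=> u u1 <-; apply/unitv_sphere/unitvE.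
apply: continuous_compact; first exact/continuous_subspaceT/continuous_trmx.
pose c : set 'rV[R]_n.+1 := [set v | forall i, `[(-1 : R), 1]%classic (v 0 i)].
apply: (@subclosed_compact _ _ c).
- apply: (@closed_comp _ _ (fun u : 'rV[R]_n.+1 => dotv u^T u^T)
      [set x | x = 1]) => [u _|].
    apply: continuous_sum => i {}u.
    by under eq_fun do rewrite !mxE; apply: continuousM; apply: coord_continuous.
  exact: closed_eq.
- apply: (@rV_compact _ _ (fun=> `[(-1 : R), 1]%classic)) => i.
  exact: segment_compact.
- move=> u /= u1 i; rewrite /= in_itv /=.
  have : u 0 i * u 0 i <= 1.
    rewrite -u1 /dotv (bigD1 i) //= !mxE lerDl.
    by apply: sumr_ge0 => j _; rewrite -expr2 sqr_ge0.
  by move=> ui; apply/andP; split; nra.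
Qed.

Lemma RP_compact (R : realType) n : compact [set: RP R n].
Proof.
have -> : [set: RP R n] = \pi_(RP R n)%qT @` [set: set_type (@sphere R n)].
  rewrite eqEsubset; split=> // x _; exists (repr x) => //; exact: reprK.
apply: continuous_compact; last exact/compact_set_type/sphere_compact.
exact/continuous_subspaceT/pi_continuous.
Qed.

Lemma RP_eqP (R : realType) n (x y : set_type (@sphere R n)) :
  (\pi_(RP R n) x = \pi_(RP R n) y)%qT <-> val x = val y \/ val x = - val y.
Proof.
split=> [/eqmodP/orP[/eqP|/eqP]|E]; [by left|by right|].
by apply/eqmodP/orP; case: E => /eqP; [left|right].
Qed.

(** The map on projective space induced by [h]; it is meaningful when [h] is
    even, in which case the chosen representative does not matter. *)
Definition RP_lift (R : realType) n (T : Type) (h : 'cV[R]_n.+1 -> T) :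
  RP R n -> T := (h \o set_val) \o (repr : RP R n -> set_type (@sphere R n)).

Lemma RP_lift_pi (R : realType) n (T : Type) (h : 'cV[R]_n.+1 -> T) x :
  (forall x, h (- x) = h x) -> RP_lift h (\pi_(RP R n) x)%qT = h (val x).
Proof.
move=> hN; rewrite /RP_lift /=.
have /RP_eqP : (\pi_(RP R n) (repr (\pi_(RP R n) x)) = \pi_(RP R n) x)%qT.
  exact: reprK.
by case=> /(congr1 h) //; rewrite hN.
Qed.

Lemma RP_lift_continuous (R : realType) n (T : topologicalType)
    (h : 'cV[R]_n.+1 -> T) :
  continuous h -> (forall x, h (- x) = h x) -> continuous (RP_lift h).
Proof.
move=> ch hN; apply/quotient_continuous.
rewrite (_ : RP_lift h \o _ = h \o set_val).
  move=> x; apply: continuous_comp; last exact: ch.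
  exact: initial_continuous.
by apply/funext => x; exact: RP_lift_pi.
Qed.

Lemma RP_rep (R : realType) n (z : RP R n) :
  exists2 x : set_type (@sphere R n), unitv (val x) & (\pi_(RP R n) x = z)%qT.
Proof.
exists (repr z); last exact: reprK.
by apply/unitv_sphere; exact: set_mem (valP _).
Qed.

(** * The homeomorphism *)

Lemma rot_continuous (R : realType) : continuous (@rot R).
Proof.
apply: continuous_mx.
have cx i : continuous (fun q : 'cV[R]_4 => q i 0).
  by move=> q; apply: coord_continuous.
have c2 : continuous (fun _ : 'cV[R]_4 => 2 : R) by exact: cst_continuous.
have cM (f g : 'cV[R]_4 -> R) : continuous f -> continuous g ->
    continuous (fun q => f q * g q).
  by move=> cf cg q; apply: continuousM; [exact: cf|exact: cg].
have cD (f g : 'cV[R]_4 -> R) : continuous f -> continuous g ->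
    continuous (fun q => f q + g q).
  by move=> cf cg q; apply: continuousD; [exact: cf|exact: cg].
have cN (f : 'cV[R]_4 -> R) : continuous f -> continuous (fun q => - f q).
  by move=> cf q; apply: continuousN; exact: cf.
(* The parentheses keep [cD], [cN] and [cM] in the context for later rounds. *)
elim/ord3_ind; elim/ord3_ind; under eq_fun do rewrite mxE /= ?expr2;
  by repeat first [exact: cx | exact: c2 | apply: (cD) | apply: (cN)
    | apply: (cM)].
Qed.

Lemma proj_continuous (R : realType) n : continuous (@proj R n).
Proof.
have cxx : continuous (fun x : 'cV[R]_n => x *m x^T).
  apply: (@continuous_mulmx R _ _ _ _ id trmx); first by move=> x; exact: cvg_id.
  exact: continuous_trmx.
apply: continuous_mx => i j; under eq_fun do rewrite /proj mxE [X in _ + X]mxE.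
move=> x; apply: continuousB; first exact: cst_continuous.
exact: (continuous_comp (cxx x) (@coord_continuous _ _ _ i j _)).
Qed.

(** The first factor gives the kernel line, the second the rotation. *)
Definition rot_proj (R : realType) (y : RP R 2 * RP R 3) : 'M[R]_3 :=
  RP_lift (@rot R) y.2 *m RP_lift (@proj R 3) y.1.

Lemma rot_proj_continuous (R : realType) : continuous (@rot_proj R).
Proof.
apply: continuous_mulmx => y; apply: continuous_comp.
- exact: cvg_snd.
- exact: (RP_lift_continuous (@rot_continuous R) (@rotN R)).
- exact: cvg_fst.
- exact: (RP_lift_continuous (@proj_continuous R 3) (@projN R 3)).
Qed.

Lemma rot_proj_pi (R : realType) (x : set_type (@sphere R 2))
    (q : set_type (@sphere R 3)) :
  rot_proj (\pi_(RP R 2) x, \pi_(RP R 3) q)%qT = rot (val q) *m proj (val x).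
Proof.
by rewrite /rot_proj !RP_lift_pi //; [exact: projN|exact: rotN].
Qed.

Lemma rot_proj_inj (R : realType) : injective (@rot_proj R).
Proof.
move=> [x p] [y q].
have [{}x x1 <-] := RP_rep x; have [{}y y1 <-] := RP_rep y.
have [{}p p1 <-] := RP_rep p; have [{}q q1 <-] := RP_rep q.
rewrite !rot_proj_pi => E.
have Erot : rot (val p) = rot (val q).
  rewrite -(SO3_proj_recover (rot_SO3 p1) x1) E.
  by rewrite (SO3_proj_recover (rot_SO3 q1) y1).
have Eproj : proj (val x) = proj (val y).
  by rewrite -(SO3_proj_gram (rot_SO3 p1) x1) E (SO3_proj_gram (rot_SO3 q1)).
congr (_, _); apply/RP_eqP; last exact: rot_inj.
by apply: outer_inj => //; apply/oppr_inj/(addrI 1%:M).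
Qed.

Lemma rot_proj_best (R : realType) y : best_rank2 (@rot_proj R y).
Proof.
case: y => x q; have [{}x x1 <-] := RP_rep x; have [{}q q1 <-] := RP_rep q.
rewrite rot_proj_pi; apply/best_rank2P; exists (val x) => //.
by apply: SO3_proj_gram => //; exact: rot_SO3.
Qed.

Lemma rot_proj_surj (R : realType) (A : 'M[R]_3) :
  best_rank2 A -> exists y, rot_proj y = A.
Proof.
case/best_rank2P => n n1 /(gram_proj_SO3 n1)[/rot_surj[q q1 qE] AE].
have /mem_set ns := (unitv_sphere n).2 n1; have /mem_set qs := (unitv_sphere q).2 q1.
exists (\pi_(RP R 2) (exist _ n ns), \pi_(RP R 3) (exist _ q qs))%qT.
by rewrite rot_proj_pi /= qE -AE.
Qed.

Theorem mainTheorem4 (R : realType) :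
  homeomorphic (set_type (@M5 R)) (RP R 2 * RP R 3)%type.
Proof.
pose c : R := Num.sqrt (3 / 2).
have c0 : c != 0 by rewrite gt_eqF // sqrtr_gt0 divr_gt0.
have M5g y : c *: rot_proj y \in @M5 R.
  by apply/mem_set; exists (rot_proj y) => //; exact: rot_proj_best.
pose g y : set_type (@M5 R) :=
  exist (fun A => A \in @M5 R) _ (M5g y).
apply: (@homeomorphic_compact_hausdorff _ _ g).
- rewrite -setXTT; apply: compact_setX; exact: RP_compact.
- exact/hausdorff_set_type/norm_hausdorff.
- apply: continuous_comp_initial.
  rewrite (_ : _ \o g = fun y => c%:M *m rot_proj y).
    apply: continuous_mulmx; first exact: cst_continuous.
    exact: rot_proj_continuous.
  by apply/funext => y; rewrite mul_scalar_mx.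
- by move=> y z /(congr1 val)/(scalerI c0)/rot_proj_inj.
- case=> _ /[dup] /set_mem[A /rot_proj_surj[y <-] <-] M5y.
  by exists y; exact: val_inj.
Qed.
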